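(* Let $(s_n)_{n\in\mathbb{Z}\setminus\{0\}}$, i.e. $\dots,s_{-n},s_{-n+1},\dots,s_{-1},s_1,s_2,\dots,s_n,\dots$, be the nontrivial zeros of the Riemann zeta function $\zeta$, listed in order of nondecreasing imaginary part, with $\operatorname{Im}(s_n)<0$ for $n<0$ and $\operatorname{Im}(s_n)>0$ for $n>0$. There exist a constant $C>0$ and, for each real number $t$ such that $\operatorname{Im}(s_i)<t<\operatorname{Im}(s_{i+1})$ for some integer $i$ with $i\neq 0$ and $i+1\neq 0$, a finite constant $C_t>0$ depending only on $t$, such that for every such $t$ and every $\delta>0$, $$\sup_{s\in\mathbb{C},\ \operatorname{Im}(s)=t}\Big|\ln\big(|\zeta(s)|\big)\,\theta\big(\operatorname{Re}(s)-\tfrac12-\delta\big)\Big|<\frac{5\,C\,C_t}{\delta}.$$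
   Context: $\zeta(s)$ is the Riemann zeta function, defined by $\zeta(s)=\sum_{n\ge1}n^{-s}$ for $\operatorname{Re}(s)>1$ and extended meromorphically to $\mathbb{C}$ with only a simple pole at $s=1$. $\theta$ is the Heaviside step function ($\theta(x)=1$ for $x>0$, $\theta(x)=0$ for $x<0$); the product with $\theta$ is taken to be $0$ wherever $\theta$ vanishes, so the supremum effectively runs over the points $s$ with $\operatorname{Im}(s)=t$ and $\operatorname{Re}(s)>\tfrac12+\delta$. *)

(* Defs.v *)
From Stdlib Require Import Reals ZArith.
From Coquelicot Require Import Coquelicot.
Open Scope R_scope.

Definition Cexp (z : C) : C :=
  (exp (Re z) * cos (Im z), exp (Re z) * sin (Im z)).

(** [x ^ w] for a real base [x > 0], with the real logarithm of [x]. *)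
Definition Rpos_cpow (x : R) (w : C) : C := Cexp (w * ln x)%C.

Definition C_differentiable_at (f : C -> C) (z : C) : Prop :=
  @ex_derive C_AbsRing C_NormedModule f z.

(** [f z = g z / (z - a)] near [a], with [g] holomorphic near [a] and
    [g a <> 0]; the value of [f] at [a] itself is irrelevant. *)
Definition has_simple_pole (f : C -> C) (a : C) : Prop :=
  exists g : C -> C,
    locally a (fun z => C_differentiable_at g z) /\
    g a <> RtoC 0 /\
    locally a (fun z => z <> a -> f z = (g z / (z - a))%C).

(** By the identity theorem these conditions determine [zeta] on [C \ {1}];
    [zeta 1] is an arbitrary value, so the point [1] is excluded from the
    zeros below. *)
Record is_riemann_zeta (zeta : C -> C) : Prop := {
  zeta_dirichlet_series : forall s : C, 1 < Re s ->
    @is_series C_AbsRing C_NormedModule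
      (fun k : nat => Rpos_cpow (INR (S k)) (- s)%C) (zeta s);
  zeta_holomorphic : forall s : C, s <> RtoC 1 -> C_differentiable_at zeta s;
  zeta_pole : has_simple_pole zeta (RtoC 1)
}.

(** The trivial zeros are [-2, -4, -6, ...]. *)
Definition is_nontrivial_zero (zeta : C -> C) (z : C) : Prop :=
  z <> RtoC 1 /\ zeta z = RtoC 0 /\
  ~ (exists k : nat, (1 <= k)%nat /\ z = RtoC (- (2 * INR k))).

(** [s] lists the nontrivial zeros along [Z \ {0}]; [s 0] is not used.
    A zero may occur more than once, so that listing the zeros with or without
    multiplicity is allowed: this affects neither the set of ordinates nor
    which ordinates are consecutive. *)
Record lists_nontrivial_zeros (zeta : C -> C) (s : Z -> C) : Prop := {
  listed_are_zeros : forall n : Z, n <> 0%Z -> is_nontrivial_zero zeta (s n);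
  zeros_are_listed : forall z : C, is_nontrivial_zero zeta z ->
    exists n : Z, n <> 0%Z /\ s n = z;
  listed_nondecreasing : forall m n : Z, m <> 0%Z -> n <> 0%Z -> (m <= n)%Z ->
    Im (s m) <= Im (s n);
  listed_negative : forall n : Z, (n < 0)%Z -> Im (s n) < 0;
  listed_positive : forall n : Z, (0 < n)%Z -> 0 < Im (s n)
}.

Definition between_consecutive_zeros (s : Z -> C) (t : R) : Prop :=
  exists i : Z, i <> 0%Z /\ (i + 1)%Z <> 0%Z /\
    Im (s i) < t < Im (s (i + 1)%Z).

(** With value [0] at [0]. *)
Definition heaviside (x : R) : R := if Rlt_dec 0 x then 1 else 0.

(** The logarithm of [x >= 0] with [ln 0 = -oo], in place of the value [0]
    that [ln] takes at [0]. *)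
Definition ln_Rbar (x : R) : Rbar :=
  if Rlt_dec 0 x then Finite (ln x) else m_infty.

(** The supremum over [Im z = t] of [|ln |zeta z| * theta (Re z - 1/2 - delta)|];
    [Rbar_mult] satisfies [-oo * 0 = 0], so the product is [0] wherever the
    [heaviside] factor is. *)
Definition sup_log_zeta (zeta : C -> C) (t delta : R) : Rbar :=
  Rbar_lub (fun y : Rbar => exists z : C, Im z = t /\
    y = Rbar_abs (Rbar_mult (ln_Rbar (Cmod (zeta z)))
                            (Finite (heaviside (Re z - 1 / 2 - delta))))).

(* Main.v *)
Require Import Defs.
From Stdlib Require Import Reals ZArith Lra Lia IndefiniteDescription.
From Coquelicot Require Import Coquelicot.
Open Scope R_scope.

(** The height [t] lies strictly between two consecutive ordinates of zeros,
    and the excluded pair [(-1, 1)] is the only one that surrounds [0].  Hence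
    [t <> 0], so the line [Im z = t] meets neither the pole nor a trivial zero,
    and the monotonicity of the list keeps the nontrivial zeros off the line
    ([zeta_neq_0_between]).  It is then enough to bound the single function
    [(x - 1/2) * |ln |zeta (x + i t)||] over the half-line [x >= 1/2] by some
    [M]: wherever the Heaviside factor is [1] one has [delta < x - 1/2], which
    gives [|ln |zeta|| <= M / delta].

    The bound ([weighted_log_zeta_bounded]) has two parts.  On [1/2 <= x <= 4]
    the function is continuous, since [zeta] is continuous and does not vanish
    on the line, so compactness applies.  For [x >= 4] the Dirichlet series
    gives [|zeta - 1| <= 2 / x] ([Cmod_zeta_minus_1_le]): since
    [|ln y| <= 2 |y - 1|] for [y] near [1], the logarithm is then [O(1 / x)],
    which the factor [x - 1/2] turns into a bounded quantity.

    As [M] may depend on [t] in an arbitrary way, one takes [C = 1] and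
    [C_t = M + 1]; the [+ 1] makes the inequality strict and [C_t] positive. *)

(** * The Dirichlet series away from its first term *)

Lemma Cmod_Cexp (z : C) : Cmod (Cexp z) = exp (Re z).
Proof.
  unfold Cmod, Cexp; simpl fst; simpl snd.
  replace (_ + _) with (exp (Re z) ^ 2).
  - apply sqrt_pow2, Rlt_le, exp_pos.
  - pose proof (sin2_cos2 (Im z)) as H; unfold Rsqr in H.
    replace (exp (Re z) ^ 2)
      with (exp (Re z) ^ 2 * (sin (Im z) * sin (Im z) + cos (Im z) * cos (Im z)))
      by (rewrite H; ring).
    ring.
Qed.

Lemma Cmod_Rpos_cpow (x : R) (w : C) : Cmod (Rpos_cpow x w) = exp (Re w * ln x).
Proof.
  unfold Rpos_cpow; rewrite Cmod_Cexp; f_equal.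
  destruct w as [a b]; unfold Re, Cmult, RtoC; simpl; ring.
Qed.

(** Splitting off [n^(-2)] keeps the sum over [n] convergent; the remaining
    factor [n^(2 - x)] is at most [2 / x] because
    [exp ((x - 2) ln n) >= 1 + (x - 2) / 2], using [ln n >= ln 2 > 1/2]. *)
Lemma exp_ln_decay (x n : R) :
  2 <= x -> 2 <= n -> exp (- x * ln n) <= 2 / x * (/ n ^ 2).
Proof.
  intros Hx Hn.
  assert (Hl : / 2 <= ln n).
  { apply Rle_trans with (ln 2); [left; apply ln_lt_2 | apply ln_le; lra]. }
  assert (E : exp (- x * ln n) = / exp ((x - 2) * ln n) * / n ^ 2).
  { replace (n ^ 2) with (exp (ln n + ln n)) by (rewrite exp_plus, exp_ln by lra; ring).
    rewrite <- !exp_Ropp, <- exp_plus; f_equal; ring. }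
  rewrite E; apply Rmult_le_compat_r.
  - left; apply Rinv_0_lt_compat, pow_lt; lra.
  - replace (2 / x) with (/ (x / 2)) by (field; lra).
    apply Rinv_le_contravar; [lra |].
    pose proof (exp_ineq1_le ((x - 2) * ln n)); nra.
Qed.

(** The right-hand side is written as a difference so that its sum over [k]
    telescopes. *)
Lemma dirichlet_term_le (s : C) (k : nat) : 2 <= Re s ->
  Cmod (Rpos_cpow (INR (S (S k))) (- s)%C)
  <= 2 / Re s * (/ INR (S k) - / INR (S (S k))).
Proof.
  intros Hs.
  assert (Hk : 1 <= INR (S k)) by (rewrite S_INR; pose proof (pos_INR k); lra).
  rewrite Cmod_Rpos_cpow, (S_INR (S k)).
  set (m := INR (S k)) in *.
  replace (Re (- s)%C) with (- Re s) by (destruct s; reflexivity).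
  eapply Rle_trans; [apply exp_ln_decay; lra |].
  apply Rmult_le_compat_l; [apply Rdiv_le_0_compat; lra |].
  replace (/ m - / (m + 1)) with (/ (m * (m + 1))) by (field; lra).
  apply Rinv_le_contravar; nra.
Qed.

Lemma Cmod_is_series_le (a : nat -> C) (b : nat -> R) (l : C) (B : R) :
  (forall k, Cmod (a k) <= b k) -> (forall n, sum_n b n <= B) ->
  @is_series C_AbsRing C_NormedModule a l -> Cmod l <= B.
Proof.
  intros Hab Hb Hl.
  apply (is_lim_seq_le (fun n => Cmod (@sum_n C_NormedModule a n)) (fun _ => B)
           (Finite (Cmod l)) (Finite B)).
  - intros n; apply Rle_trans with (sum_n b n); [| apply Hb].
    eapply Rle_trans; [apply (@norm_sum_n_m C_AbsRing C_NormedModule) |].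
    apply sum_n_m_le, Hab.
  - eapply filterlim_comp;
      [exact Hl | apply (@filterlim_norm C_AbsRing C_NormedModule)].
  - apply is_lim_seq_const.
Qed.

Lemma Cmod_zeta_minus_1_le (zeta : C -> C) (Hzeta : is_riemann_zeta zeta) (s : C) :
  2 <= Re s -> Cmod (zeta s - 1)%C <= 2 / Re s.
Proof.
  intros Hs.
  assert (Hc : 0 <= 2 / Re s) by (apply Rdiv_le_0_compat; lra).
  apply (Cmod_is_series_le (fun k => Rpos_cpow (INR (S (S k))) (- s)%C)
           (fun k => 2 / Re s * (/ INR (S k) - / INR (S (S k))))).
  - intros k; now apply dirichlet_term_le.
  - intros n.
    assert (E : sum_n (fun k => 2 / Re s * (/ INR (S k) - / INR (S (S k)))) n
                = 2 / Re s * (1 - / INR (S (S n))) :> R).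
    { induction n as [| n IH].
      - rewrite sum_O; simpl; f_equal; field.
      - rewrite sum_Sn, IH; change (@plus R_AbelianMonoid) with Rplus; ring. }
    rewrite E.
    assert (0 < / INR (S (S n))) by (apply Rinv_0_lt_compat, lt_0_INR; lia).
    nra.
  - (* the term split off from the series is [1 ^ (- s) = 1] *)
    assert (E : Rpos_cpow (INR 1) (- s)%C = RtoC 1).
    { unfold Rpos_cpow, Cexp, INR; rewrite ln_1.
      replace (- s * 0)%C with (RtoC 0) by ring.
      unfold RtoC; simpl; rewrite exp_0, cos_0, sin_0; f_equal; ring. }
    apply (@is_series_incr_1 C_AbsRing C_NormedModule
             (fun k => Rpos_cpow (INR (S k)) (- s)%C)).
    rewrite E.
    replace (@plus C_NormedModule (zeta s - 1)%C (RtoC 1)) with (zeta s)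
      by (change (zeta s = (zeta s - 1 + 1)%C); ring).
    apply (zeta_dirichlet_series _ Hzeta s); lra.
Qed.

(** * The logarithm of the modulus on a horizontal line *)

Lemma abs_ln_le_near_1 (x : R) : Rabs (x - 1) <= / 2 -> Rabs (ln x) <= 2 * Rabs (x - 1).
Proof.
  intros Hx.
  assert (H : / 2 <= x) by (revert Hx; unfold Rabs; destruct (Rcase_abs _); lra).
  assert (Hup : ln x <= x - 1).
  { pose proof (exp_ineq1_le (ln x)) as E; rewrite exp_ln in E; lra. }
  (* the same inequality at [/ x] bounds [ln x] from below *)
  assert (Hlo : x * (1 - ln x) <= 1).
  { pose proof (exp_ineq1_le (- ln x)) as E; rewrite exp_Ropp, exp_ln in E by lra.
    apply Rmult_le_compat_l with (r := x) in E; [| lra].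
    rewrite Rinv_r in E; lra. }
  revert Hx; unfold Rabs.
  destruct (Rcase_abs (ln x)), (Rcase_abs (x - 1)); intros; nra.
Qed.

Lemma weighted_log_zeta_far (zeta : C -> C) (Hzeta : is_riemann_zeta zeta) (x t : R) :
  4 <= x -> (x - 1 / 2) * Rabs (ln (Cmod (zeta (x, t)))) <= 4.
Proof.
  intros Hx.
  pose proof (Cmod_zeta_minus_1_le zeta Hzeta (x, t)) as H; simpl Re in H.
  specialize (H ltac:(lra)).
  assert (Habs : Rabs (Cmod (zeta (x, t)) - 1) <= 2 / x).
  { eapply Rle_trans; [| exact H].
    rewrite <- Cmod_1 at 1.
    apply (@norm_triangle_inv C_AbsRing C_NormedModule). }
  assert (Hinv : x * (2 / x) = 2) by (field; lra).
  assert (Hln : Rabs (ln (Cmod (zeta (x, t)))) <= 2 * (2 / x)).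
  { eapply Rle_trans; [apply abs_ln_le_near_1; nra | lra]. }
  pose proof (Rabs_pos (ln (Cmod (zeta (x, t))))).
  nra.
Qed.

Lemma continuous_Cmod_zeta_line (zeta : C -> C) (Hzeta : is_riemann_zeta zeta)
  (t x : R) : t <> 0 -> continuity_pt (fun y => Cmod (zeta (y, t))) x.
Proof.
  intros Ht; apply continuity_pt_filterlim.
  apply (filterlim_comp R C R (fun y => zeta (y, t)) Cmod _
           (@locally C_NormedModule (zeta (x, t))));
    [| apply (@filterlim_norm C_AbsRing C_NormedModule)].
  apply (filterlim_comp R C C (fun y => (y, t)) zeta _
           (@locally (AbsRing_UniformSpace C_AbsRing) (x, t))).
  - apply (filterlim_locally (U := AbsRing_UniformSpace C_AbsRing) (fun y => (y, t))).
    intros eps; exists eps; intros y Hy.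
    change (Cmod ((y, t) - (x, t))%C < eps).
    replace ((y, t) - (x, t))%C with (RtoC (y - x)).
    + rewrite Cmod_R; exact Hy.
    + unfold RtoC, Cminus, Cplus, Copp; simpl; f_equal; ring.
  - apply (@ex_derive_continuous C_AbsRing C_NormedModule zeta (x, t)).
    apply (zeta_holomorphic _ Hzeta); intros E; apply Ht.
    now injection E.
Qed.

Lemma weighted_log_zeta_bounded (zeta : C -> C) (Hzeta : is_riemann_zeta zeta)
  (t : R) : t <> 0 -> (forall x, zeta (x, t) <> RtoC 0) ->
  exists M, forall x, 1 / 2 <= x ->
    (x - 1 / 2) * Rabs (ln (Cmod (zeta (x, t)))) <= M.
Proof.
  intros Ht Hz.
  destruct (continuity_ab_maj
              (fun x => (x - 1 / 2) * Rabs (ln (Cmod (zeta (x, t))))) (1 / 2) 4)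
    as (m & Hm & _); [lra | |].
  - intros x _.
    apply (continuity_pt_mult (fun x => x - 1 / 2)
             (fun x => Rabs (ln (Cmod (zeta (x, t)))))).
    + reg.
    + apply (continuity_pt_comp (fun x => ln (Cmod (zeta (x, t)))) Rabs);
        [| apply Rcontinuity_abs].
      apply (continuity_pt_comp (fun x => Cmod (zeta (x, t))) ln).
      * now apply continuous_Cmod_zeta_line.
      * apply derivable_continuous_pt.
        exists (/ Cmod (zeta (x, t))).
        apply derivable_pt_lim_ln, Cmod_gt_0, Hz.
  - eexists (Rmax _ 4); intros x Hx.
    destruct (Rle_dec x 4) as [H4 | H4].
    + eapply Rle_trans; [apply Hm; lra | apply Rmax_l].
    + eapply Rle_trans; [apply weighted_log_zeta_far; [assumption | lra] | apply Rmax_r].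
Qed.

(** * Heights between consecutive zeros *)

Lemma between_consecutive_zeros_neq_0 (zeta : C -> C) (s : Z -> C)
  (Hs : lists_nontrivial_zeros zeta s) (t : R) :
  between_consecutive_zeros s t -> t <> 0.
Proof.
  intros (i & Hi & Hi' & H1 & H2).
  destruct (Z_lt_ge_dec i 0) as [Hn | Hp].
  - pose proof (listed_negative _ _ Hs (i + 1)%Z ltac:(lia)); lra.
  - pose proof (listed_positive _ _ Hs i ltac:(lia)); lra.
Qed.

Lemma zeta_neq_0_between (zeta : C -> C) (s : Z -> C)
  (Hs : lists_nontrivial_zeros zeta s) (t : R) :
  between_consecutive_zeros s t -> forall x, zeta (x, t) <> RtoC 0.
Proof.
  intros Ht x E.
  pose proof (between_consecutive_zeros_neq_0 _ _ Hs t Ht) as Ht0.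
  destruct Ht as (i & Hi & Hi' & H1 & H2).
  destruct (zeros_are_listed _ _ Hs (x, t)) as (n & Hn & En).
  - split; [| split]; [| exact E |].
    + intros F; apply Ht0; now injection F.
    + intros (k & _ & F); apply Ht0; now injection F.
  - destruct (Z_le_gt_dec n i) as [Hle | Hgt].
    + pose proof (listed_nondecreasing _ _ Hs n i Hn Hi Hle) as H.
      rewrite En in H; simpl in H; lra.
    + pose proof (listed_nondecreasing _ _ Hs (i + 1)%Z n Hi' Hn ltac:(lia)) as H.
      rewrite En in H; simpl in H; lra.
Qed.

(** * The supremum *)

Lemma sup_log_zeta_le (zeta : C -> C) (t delta M : R) :
  0 < delta -> (forall x, zeta (x, t) <> RtoC 0) ->
  (forall x, 1 / 2 <= x -> (x - 1 / 2) * Rabs (ln (Cmod (zeta (x, t)))) <= M) ->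
  Rbar_le (sup_log_zeta zeta t delta) (Finite (M / delta)).
Proof.
  intros Hd Hz HM.
  unfold sup_log_zeta, Rbar_lub.
  destruct (Rbar_ex_lub _) as [l [Hub Hl]]; simpl.
  apply Hl; intros y ([x u] & Hu & ->); simpl in Hu; subst u.
  unfold ln_Rbar, heaviside.
  destruct (Rlt_dec 0 (Cmod (zeta (x, t)))) as [_ | H];
    [| exfalso; apply H, Cmod_gt_0, Hz].
  simpl.
  apply Rmult_le_reg_r with delta; [exact Hd |].
  replace (M / delta * delta) with M by (field; lra).
  destruct (Rlt_dec 0 (x - 1 / 2 - delta)) as [H | H].
  - rewrite Rmult_1_r.
    pose proof (HM x ltac:(lra)).
    pose proof (Rabs_pos (ln (Cmod (zeta (x, t))))).
    nra.
  - (* at [x = 1/2] the weight vanishes, so [M] is nonnegative *)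
    rewrite Rmult_0_r, Rabs_R0, Rmult_0_l.
    pose proof (HM (1 / 2) ltac:(lra)); lra.
Qed.

Theorem theorem1 (zeta : C -> C) (Hzeta : is_riemann_zeta zeta)
    (s : Z -> C) (Hs : lists_nontrivial_zeros zeta s) :
  exists C0 : R, 0 < C0 /\
  exists Ct : R -> R,
    (forall t : R, between_consecutive_zeros s t -> 0 < Ct t) /\
    (forall t : R, between_consecutive_zeros s t ->
     forall delta : R, 0 < delta ->
       Rbar_lt (sup_log_zeta zeta t delta)
               (Finite (5 * C0 * Ct t / delta))).
Proof.
  exists 1; split; [lra |].
  destruct (functional_choice
    (fun t c => between_consecutive_zeros s t -> 0 < c /\
       forall delta, 0 < delta ->
         Rbar_lt (sup_log_zeta zeta t delta) (Finite (5 * 1 * c / delta))))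
    as [Ct HCt].
  - intros t.
    destruct (Classical_Prop.classic (between_consecutive_zeros s t)) as [Ht | Ht];
      [| exists 0; intros; contradiction].
    pose proof (zeta_neq_0_between _ _ Hs t Ht) as Hz.
    destruct (weighted_log_zeta_bounded zeta Hzeta t
                (between_consecutive_zeros_neq_0 _ _ Hs t Ht) Hz) as [M HM].
    assert (HM0 : 0 <= M) by (pose proof (HM (1 / 2) ltac:(lra)); lra).
    exists (M + 1); intros _; split; [lra |].
    intros delta Hd.
    eapply Rbar_le_lt_trans; [now apply sup_log_zeta_le with (M := M) |].
    apply Rmult_lt_compat_r; [now apply Rinv_0_lt_compat | lra].
  - exists Ct; split; intros t Ht; now apply (HCt t).
Qed.
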